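(* For $n\ge 1$, $a_n(12;1\to 2)=B_n$, the $n$-th Bell number.
   Context: Standard cycle form of $\sigma\in S_n$: product of disjoint cycles (fixed points included), each cycle starting with its largest element, cycles listed in increasing order of largest elements. The fundamental bijection $\theta:S_n\to S_n$ erases the parentheses of the standard cycle form to give a one-line permutation. For $\pi\in S_n$, $\hat\pi=\theta^{-1}(\pi)$. An arrow pattern $(\nu;H)$ of size $k$: a string $\nu=a_1\dots a_m$ of positive integers and a set $H$ of arrows $b\to c$, with all integers appearing forming $[k]$. $\pi\in S_n$ contains $(\nu;H)$ if there is $X=\{x_1<\dots<x_k\}\subseteq[n]$ with positions $t_1<\dots<t_m$ such that $\pi_{t_1}\cdots\pi_{t_m}=x_{a_1}\cdots x_{a_m}$ and $\hat\pi(x_b)=x_c$ for every arrow $b\to c\in H$; otherwise it avoids it. $a_n(\nu;H)$ = number of $\pi\in S_n$ avoiding $(\nu;H)$. $B_n$ is the number of set partitions of $[n]$. *)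

(* Defs.v *)
From mathcomp Require Import all_boot fingroup perm.

Set Implicit Arguments.
Unset Strict Implicit.
Unset Printing Implicit Defensive.

(* [n] is represented by 'I_n, i.e. shifted down by one to {0, ..., n-1};
   S_n is {perm 'I_n}, and the one-line word of pi is pi 0, ..., pi (n-1). *)

Section FundamentalBijection.

Variable n : nat.
Implicit Types (s pi : {perm 'I_n}) (x y : 'I_n).

Definition cycle_max s x := [forall y in porbit s x, y <= x].

(* enum 'I_n is increasing, so the cycles come in increasing order of their
   largest elements; the cycle of x is written x, s x, s (s x), ... *)
Definition standard_cycle_form s : seq (seq 'I_n) :=
  [seq traject s x #|porbit s x| | x <- enum 'I_n & cycle_max s x].

Definition theta_word s : seq 'I_n := flatten (standard_cycle_form s).

Lemma porbit_max s x : exists2 y, y \in porbit s x & cycle_max s y.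
Proof.
have [y yx ymax] := @arg_maxnP _ x [in porbit s x] (@nat_of_ord n) (porbit_id s x).
exists y => //; apply/forall_inP => z zy; apply: ymax.
by move: zy; rewrite -eq_porbit_mem (eqP (_ : porbit s y == porbit s x)) ?eq_porbit_mem.
Qed.

Lemma theta_word_mem s x : x \in theta_word s.
Proof.
have [y yx ymax] := porbit_max s x.
apply/flatten_mapP; exists y; first by rewrite mem_filter ymax mem_enum.
by rewrite -porbit_traject porbit_sym.
Qed.

Lemma uniq_theta_word s : uniq (theta_word s).
Proof.
have: uniq [seq x <- enum 'I_n | cycle_max s x] by rewrite filter_uniq ?enum_uniq.
have: all (cycle_max s) [seq x <- enum 'I_n | cycle_max s x] by exact: filter_all.
rewrite /theta_word /standard_cycle_form.
elim: [seq x <- _ | _] => //= x l IHl /andP[mx ml] /andP[xl ul].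
rewrite cat_uniq uniq_traject_porbit IHl // andbT /=.
apply/hasPn => z /flatten_mapP[y yl]; rewrite -!porbit_traject => zy.
apply/negP => zx; case/negP: xl.
suff -> : x = y by [].
have exy : porbit s x = porbit s y.
  by move: zx zy; rewrite -!eq_porbit_mem => /eqP<- /eqP.
apply/val_inj/anti_leq; rewrite (forall_inP (allP ml _ yl)) ?(forall_inP mx) //.
  by rewrite exy porbit_id.
by rewrite -exy porbit_id.
Qed.

Lemma size_theta_word s : size (theta_word s) = n.
Proof.
rewrite -[RHS]card_ord -(card_uniqP (uniq_theta_word s)).
by apply: eq_card => x; rewrite theta_word_mem.
Qed.

Lemma theta_subproof s : injective (fun i : 'I_n => nth i (theta_word s) i).
Proof.
move=> i j /=; rewrite (set_nth_default j) ?size_theta_word //.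
move/eqP; rewrite nth_uniq ?size_theta_word ?uniq_theta_word //.
by move/eqP/val_inj.
Qed.

Definition theta s : {perm 'I_n} := perm (@theta_subproof s).

Lemma take_first_cycle (f : 'I_n -> seq 'I_n) (x : 'I_n) (r l : seq 'I_n) :
    all (fun y : 'I_n => y <= x) r -> path (fun y z : 'I_n => y < z) x l ->
  let w := r ++ flatten [seq y :: f y | y <- l] in
  take (find (fun y : 'I_n => x < y) w) w = r.
Proof.
move=> rx xl /=; rewrite find_cat ifN; last first.
  by rewrite -all_predC; apply: sub_all rx => y /=; rewrite -leqNgt.
suff -> : find (fun y : 'I_n => x < y) (flatten [seq y :: f y | y <- l]) = 0.
  by rewrite addn0 take_size_cat.
by case: l xl => //= y l /andP[-> _].
Qed.

Lemma flatten_cycles_inj (f g : 'I_n -> seq 'I_n) (l1 l2 : seq 'I_n) :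
    (forall x, x \in l1 -> all (fun y : 'I_n => y <= x) (f x)) ->
    (forall x, x \in l2 -> all (fun y : 'I_n => y <= x) (g x)) ->
    sorted (fun x y : 'I_n => x < y) l1 -> sorted (fun x y : 'I_n => x < y) l2 ->
    flatten [seq x :: f x | x <- l1] = flatten [seq x :: g x | x <- l2] ->
  [seq x :: f x | x <- l1] = [seq x :: g x | x <- l2].
Proof.
elim: l1 l2 => [|x l1 IHl] [|y l2] //= fP gP sx sy [exy ef].
move: exy fP sx ef => -> fP sx ef; clear x.
have efg : f y = g y.
  rewrite -(take_first_cycle f (fP y (mem_head _ _)) sx).
  by rewrite -(take_first_cycle g (gP y (mem_head _ _)) sy) ef.
congr ((_ :: _) :: _) => //; apply: IHl.
- by move=> z zl; apply: fP; rewrite inE zl orbT.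
- by move=> z zl; apply: gP; rewrite inE zl orbT.
- exact: path_sorted sx.
- exact: path_sorted sy.
by move/eqP: ef; rewrite efg eqseq_cat // => /andP[_ /eqP].
Qed.

Lemma standard_cycle_formE s : standard_cycle_form s =
  [seq x :: traject s (s x) #|porbit s x|.-1 | x <- enum 'I_n & cycle_max s x].
Proof.
apply: eq_map => x; rewrite -trajectS prednK //.
by apply/card_gt0P; exists x; exact: porbit_id.
Qed.

Lemma sorted_cycle_maxima s :
  sorted (fun x y : 'I_n => x < y) [seq x <- enum 'I_n | cycle_max s x].
Proof.
apply: sorted_filter => [? ? ?|]; first exact: ltn_trans.
by rewrite -(@sorted_map _ _ (@nat_of_ord n) ltn) val_enum_ord iota_ltn_sorted.
Qed.

Lemma theta_word_inj : injective theta_word.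
Proof.
have low s x : x \in [seq x <- enum 'I_n | cycle_max s x] ->
    all (fun y : 'I_n => y <= x) (traject s (s x) #|porbit s x|.-1).
  rewrite mem_filter => /andP[/forall_inP mx _]; apply/allP => y yt; apply: mx.
  have x0 : 0 < #|porbit s x| by apply/card_gt0P; exists x; exact: porbit_id.
  by rewrite porbit_traject -(prednK x0) trajectS inE yt orbT.
move=> s1 s2 e12.
have {}e12 : standard_cycle_form s1 = standard_cycle_form s2.
  move: e12; rewrite /theta_word !standard_cycle_formE.
  by apply: flatten_cycles_inj; [exact: low | exact: low | |];
    exact: sorted_cycle_maxima.
have nextE s c x : c \in standard_cycle_form s -> x \in c -> s x = next c x.
  move=> /mapP[y _ ->] xc; apply/eqP; apply: (next_cycle (e := frel s)) => //.
  have y0 : 0 < #|porbit s y| by apply/card_gt0P; exists y; exact: porbit_id.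
  rewrite -(prednK y0) /= rcons_path fpath_traject /= last_traject.
  by rewrite -iterS prednK // iter_porbit.
apply/permP => x; have /flattenP[c c1 xc] := theta_word_mem s1 x.
by rewrite (nextE s1 c) // (nextE s2 c) // -e12.
Qed.

Lemma theta_inj : injective theta.
Proof.
move=> s1 s2 /permP e12; apply: theta_word_inj.
have [n0 | n_gt0] := posnP n.
  by rewrite !(size0nil (etrans (size_theta_word _) n0)).
pose x0 := Ordinal n_gt0.
apply: (@eq_from_nth _ x0); rewrite !size_theta_word // => i lt_in.
have := e12 (Ordinal lt_in); rewrite !permE.
by rewrite !(set_nth_default x0 (Ordinal lt_in)) ?size_theta_word.
Qed.

Definition hat pi : {perm 'I_n} := invF theta_inj pi.

Lemma hatK : cancel hat theta.
Proof. exact: f_invF. Qed.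

Lemma thetaK : cancel theta hat.
Proof. exact: invF_f. Qed.

End FundamentalBijection.

(* nu = a_1 ... a_m, and (b, c) \in H stands for the arrow b -> c; letters
   are shifted down by one, as above. *)
Record arrow_pattern (k m : nat) := ArrowPattern {
  pattern_word : m.-tuple 'I_k;
  pattern_arrows : {set 'I_k * 'I_k};
  pattern_letters : forall i : 'I_k,
    i \in pattern_word \/
    exists2 b : 'I_k * 'I_k, b \in pattern_arrows & i = b.1 \/ i = b.2
}.

Definition increasing k n (x : 'I_k -> 'I_n) :=
  [forall i : 'I_k, forall j : 'I_k, (i < j) ==> (x i < x j)].

(* x enumerates X = {x_1 < ... < x_k}, t the positions t_1 < ... < t_m *)
Definition contains n k m (pi : {perm 'I_n}) (p : arrow_pattern k m) :=
  [exists x : {ffun 'I_k -> 'I_n}, exists t : {ffun 'I_m -> 'I_n},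
    [&& increasing x, increasing t,
        [forall j, pi (t j) == x (tnth (pattern_word p) j)] &
        [forall b in pattern_arrows p, hat pi (x b.1) == x b.2]]].

Definition avoids n k m (pi : {perm 'I_n}) (p : arrow_pattern k m) :=
  ~~ contains pi p.

Definition num_avoiders n k m (p : arrow_pattern k m) :=
  #|[set pi : {perm 'I_n} | avoids pi p]|.

Definition letter1 : 'I_2 := ord0.
Definition letter2 : 'I_2 := ord_max.

Lemma pattern_12_1to2_letters (i : 'I_2) :
  i \in [tuple letter1; letter2] \/
  exists2 b : 'I_2 * 'I_2, b \in [set (letter1, letter2)] & i = b.1 \/ i = b.2.
Proof. by left; case: i => [[|[|]]]. Qed.

Definition pattern_12_1to2 : arrow_pattern 2 2 :=
  ArrowPattern pattern_12_1to2_letters.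

Definition bell n := #|[set P : {set {set 'I_n}} | partition P [set: 'I_n]]|.

(* Main.v *)
Require Import Defs.
From mathcomp Require Import all_boot fingroup perm.

(** Write [s = hat pi]. Along a cycle in standard form each element but the last
is immediately followed in the word of [pi] by its image under [s], whereas the
image of the last element is the first one, which stands to its left. Hence
[pi] avoids [(12; 1 -> 2)] exactly when every cycle of [s], written from its
largest element, is decreasing. Such an [s] is determined by the partition of
['I_n] into its cycles, and this partition is arbitrary. *)

Section DecreasingCycles.

Set Implicit Arguments.
Unset Strict Implicit.
Unset Printing Implicit Defensive.

Variable n : nat.
Implicit Types (s pi : {perm 'I_n}) (x y m : 'I_n) (B : {set 'I_n}).

Let gt_ord : rel 'I_n := fun x y => y < x.

(** [enum] lists ordinals in increasing order. Read cyclically, this list is the one decreasing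
    cycle with support [B]. *)
Definition decreasing_enum B : seq 'I_n := rev (enum B).

Lemma mem_decreasing_enum B : decreasing_enum B =i B.
Proof. by move=> x; rewrite mem_rev mem_enum. Qed.

Lemma decreasing_enum_uniq B : uniq (decreasing_enum B).
Proof. by rewrite rev_uniq enum_uniq. Qed.

Lemma sorted_decreasing_enum B : sorted gt_ord (decreasing_enum B).
Proof.
rewrite rev_sorted [enum _]/enum_mem.
apply: sorted_filter => [? ? ?|]; first exact: ltn_trans.
rewrite -enumT -(@sorted_map _ _ (@nat_of_ord n) ltn) val_enum_ord.
exact: iota_ltn_sorted.
Qed.

Lemma eq_decreasing_enum B (c : seq 'I_n) :
  sorted gt_ord c -> c =i B -> c = decreasing_enum B.
Proof.
move=> sc cB; apply: (@irr_sorted_eq _ gt_ord) sc (sorted_decreasing_enum B) _.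
- by move=> y x z xy yz; apply: ltn_trans yz xy.
- by move=> x; rewrite /gt_ord ltnn.
by move=> x; rewrite cB mem_decreasing_enum.
Qed.

Lemma fcycle_traject_porbit s x : fcycle s (traject s x #|porbit s x|).
Proof.
have x0 : 0 < #|porbit s x| by apply/card_gt0P; exists x; exact: porbit_id.
rewrite -(prednK x0) /= rcons_path fpath_traject /= last_traject.
by rewrite -iterS prednK // iter_porbit.
Qed.

Lemma porbit_fcycle s (c : seq 'I_n) x :
  fcycle s c -> x \in c -> porbit s x =i c.
Proof.
move=> sc xc y; rewrite -(fconnect_cycle sc xc).
apply/porbitP/idP => [[i ->]|/iter_findex <-].
  by rewrite permX fconnect_iter.
by exists (findex s x y); rewrite permX.
Qed.

(** Since [next] wraps around, no starting element has to be chosen, and [s x] is visibly a function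
    of the orbit of [x] alone; injectivity will come from this. *)
Definition decreasing_cycles s :=
  [forall x, s x == next (decreasing_enum (porbit s x)) x].

Lemma decreasing_cyclesP s :
  reflect (forall x, cycle_max s x -> sorted gt_ord (traject s x #|porbit s x|))
          (decreasing_cycles s).
Proof.
apply: (iffP forallP) => [sP m mm | sP x].
  have cs : fcycle s (decreasing_enum (porbit s m)).
    (* Every [x] in the list has the same orbit as [m], so [s] acts on the whole list as [next] of
       that one list. *)
    have e : {in decreasing_enum (porbit s m) &, frel s =2
               frel (next (decreasing_enum (porbit s m)))}.
      move=> x y; rewrite mem_decreasing_enum => xm _ /=.
      rewrite (eqP (sP x)); congr (next (decreasing_enum _) _ == _).
      by apply/eqP; rewrite eq_porbit_mem.
    by rewrite (eq_in_cycle e) ?cycle_next ?decreasing_enum_uniq.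
  have sc := sorted_decreasing_enum (porbit s m).
  have mc : m \in decreasing_enum (porbit s m).
    by rewrite mem_decreasing_enum porbit_id.
  have sz : size (decreasing_enum (porbit s m)) = #|porbit s m|.
    by rewrite size_rev -cardE.
  have cB := mem_decreasing_enum (porbit s m).
  case: (decreasing_enum _) cs sc mc sz cB => // y c cs sc mc sz cB.
  (* The maximality of [m] gives [y <= m]; conversely [m] lies in a decreasing list headed by
     [y]. *)
  have ym : y = m.
    apply/val_inj/anti_leq/andP; split.
      by apply: (forall_inP mm); rewrite -cB mem_head.
    move: mc sc; rewrite inE => /predU1P[->//|mc] /=.
    rewrite path_sortedE; last by move=> ? ? ? a b; apply: ltn_trans b a.
    by case/andP=> /allP/(_ _ mc) /ltnW.
  (* A path of [s] is determined by its start and its length, so the list is the trajectory of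
     [m]. *)
  rewrite -sz -ym; move: cs sc; rewrite /= rcons_path.
  by case/andP=> /fpathP[k ->] _; rewrite size_traject.
have [m mx mm] := porbit_max s x.
have e : porbit s x = porbit s m by apply/eqP; rewrite eq_porbit_mem porbit_sym.
rewrite e -(@eq_decreasing_enum _ _ (sP m mm)); last first.
  by move=> y; rewrite -porbit_traject.
apply: (next_cycle (e := frel s)); first exact: fcycle_traject_porbit.
by rewrite -porbit_traject -e porbit_id.
Qed.

(** The cycle of [m] is a contiguous block of the word, and [k] is the total length of the cycles
    before it. *)
Lemma index_theta_word s m : cycle_max s m ->
  exists k, forall i, i < #|porbit s m| ->
    index (iter i s m) (theta_word s) = k + i.
Proof.
move=> mm; have := uniq_theta_word s; rewrite /theta_word /standard_cycle_form.
have : m \in [seq x <- enum 'I_n | cycle_max s x] by rewrite mem_filter mm mem_enum.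
case/splitPr => l1 l2; rewrite map_cat flatten_cat /=.
set A := flatten _; set B := flatten _; set c := traject _ _ _ => u.
exists (size A) => i ir; have ic : iter i s m = nth m c i by rewrite nth_traject.
have mem_c : iter i s m \in c by rewrite ic mem_nth ?size_traject.
(* [index] finds the first occurrence, so uniqueness of the word is used to exclude earlier
   cycles. *)
move: u; rewrite cat_uniq => /and3P[_ /hasPn cA].
rewrite cat_uniq => /andP[uc _].
rewrite index_cat ifN ?index_cat ?mem_c; first by rewrite ic index_uniq ?size_traject.
by apply: cA; rewrite mem_cat mem_c.
Qed.

(** The arrow forces the larger value to be the image of the smaller one, and values determine
    positions, so an occurrence amounts to a single [x]. *)
Lemma contains_pattern_12_1to2 s :
  reflect (exists2 x : 'I_n, x < s x & index x (theta_word s) < index (s x) (theta_word s))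
          (contains (theta s) pattern_12_1to2).
Proof.
have thetaE i x : (theta s i == x) = (nat_of_ord i == index x (theta_word s)).
  rewrite permE; apply/eqP/eqP => [<-|->]; last exact/nth_index/theta_word_mem.
  by rewrite index_uniq ?uniq_theta_word ?size_theta_word.
apply: (iffP existsP) => [[x /existsP[t]] | [x xs ixs]].
  case/and4P=> /forallP/(_ letter1)/forallP/(_ letter2)/= lx.
  move=> /forallP/(_ letter1)/forallP/(_ letter2)/= lt.
  move=> /forallP pt /forall_inP/(_ _ (set11 _)) /=; rewrite thetaK => /eqP sx.
  move: (pt letter1) (pt letter2); rewrite !thetaE /= => /eqP t1 /eqP t2.
  exists (x letter1); first by rewrite sx.
  by rewrite sx -[X in X < _]t1 -[X in _ < X]t2.
have ltw y : index y (theta_word s) < n.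
  by rewrite -[X in _ < X](size_theta_word s) index_mem theta_word_mem.
pose a := [ffun i : 'I_2 => if i == letter1 then x else s x].
exists a; apply/existsP; exists [ffun i => Ordinal (ltw (a i))].
have incr (f : 'I_2 -> 'I_n) : f letter1 < f letter2 -> increasing f.
  move=> lf; apply/forallP => i; apply/forallP => j; apply/implyP => ij.
  suff [-> ->] : i = letter1 /\ j = letter2 by [].
  by split; apply: val_inj; case: i j ij => [[|[|//]] ?] [[|[|//]] ?].
apply/and4P; split.
- by apply: incr; rewrite !ffunE.
- by apply: incr; rewrite !ffunE.
- apply/forallP => j; rewrite thetaE ffunE /=; apply/eqP; congr index.
  by case: j => -[|[|//]] j2; rewrite !ffunE.
by apply/forall_inP => b /set1P->; rewrite thetaK !ffunE.
Qed.

Lemma avoids_decreasing_cycles s :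
  avoids (theta s) pattern_12_1to2 = decreasing_cycles s.
Proof.
apply/idP/decreasing_cyclesP => [av m mm | sP].
  apply/(sortedP m) => i; rewrite size_traject => ir.
  rewrite !nth_traject ?(ltnW ir) // /gt_ord ltnNge.
  apply: contra av => le_i; apply/contains_pattern_12_1to2.
  have [k kP] := index_theta_word mm.
  have lt_idx : index (iter i s m) (theta_word s) <
                index (iter i.+1 s m) (theta_word s).
    by rewrite !kP ?(ltnW ir) // ltn_add2l.
  (* Equal values would have equal indices, so the weak inequality between consecutive entries is
     strict. *)
  exists (iter i s m) => //; rewrite ltn_neqAle le_i andbT.
  by apply: contraTneq lt_idx => /val_inj {1}->; rewrite -leqNgt.
apply/contains_pattern_12_1to2 => -[x xs].
have [m mx mm] := porbit_max s x; have [k kP] := index_theta_word mm.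
have : x \in traject s m #|porbit s m| by rewrite -porbit_traject porbit_sym.
case/trajectP => i ir xi; rewrite {}xi -iterS in xs *.
(* If [x] is not last in its cycle, [s x] follows it and is smaller, against [xs]. *)
have [ir1 | ri] := ltnP i.+1 #|porbit s m|.
  have /(sortedP m)/(_ i) := sP m mm.
  rewrite size_traject !nth_traject // => /(_ ir1); rewrite /gt_ord.
  by rewrite ltnNge ltnW.
(* If [x] is last, [s x] is [m], at offset 0 of the block, hence not to the right of [x]. *)
have -> : i.+1 = #|porbit s m| by apply/anti_leq; rewrite ir.
rewrite iter_porbit kP // -[X in index X _]/(iter 0 s m) kP; last exact: leq_ltn_trans ir.
by rewrite ltnNge addn0 leq_addr.
Qed.

Lemma porbits_decreasing_cycles_inj :
  {in decreasing_cycles &, injective (fun s => porbits s)}.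
Proof.
move=> s1 s2 /forallP d1 /forallP d2 e12; apply/permP => x.
rewrite (eqP (d1 x)) (eqP (d2 x)); congr (next (decreasing_enum _) x).
have : porbit s1 x \in porbits s2 by rewrite -e12 imset_f.
case/imsetP => y _ e1; rewrite e1; apply/esym/eqP.
by rewrite eq_porbit_mem -e1 porbit_id.
Qed.

Lemma partition_porbits s : partition (porbits s) [set: 'I_n].
Proof.
have -> : porbits s = equivalence_partition (fun x y => y \in porbit s x) setT.
  have blockE x : [set y in setT | y \in porbit s x] = porbit s x.
    by apply/setP => y; rewrite !inE.
  by apply/setP => B; apply/imsetP/imsetP => -[x _ ->]; exists x.
apply: equivalence_partitionP => x y z _ _ _; split; first exact: porbit_id.
by rewrite -!eq_porbit_mem => /eqP ->.
Qed.

(** The permutation sends [x] to its cyclic successor in the decreasing list of its block. *)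
Lemma porbits_decreasing_cycles_surj (P : {set {set 'I_n}}) :
  partition P [set: 'I_n] -> exists2 s, decreasing_cycles s & porbits s = P.
Proof.
case/and3P=> /eqP covP tiP P0.
have inP x : x \in cover P by rewrite covP inE.
pose c x := decreasing_enum (pblock P x).
have cx x : x \in c x by rewrite mem_decreasing_enum mem_pblock.
have c_eq x y : y \in c x -> c y = c x.
  rewrite mem_decreasing_enum => yx; congr decreasing_enum.
  exact: same_pblock.
(* The successor stays in the block of [x], so [prev] on the same list undoes it. *)
have f_inj : injective (fun x => next (c x) x).
  apply: (can_inj (g := fun x => prev (c x) x)) => x.
  by rewrite (c_eq x) ?mem_next // prev_next ?decreasing_enum_uniq.
pose s := perm f_inj.
have porbitE x : porbit s x = pblock P x.
  apply/setP => y; rewrite -[RHS]mem_decreasing_enum.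
  apply: porbit_fcycle (cx x) y.
  have e : {in c x &, frel s =2 frel (next (c x))}.
    by move=> y z yx _; rewrite /= permE (c_eq x).
  by rewrite (eq_in_cycle e) ?cycle_next ?decreasing_enum_uniq.
exists s; first by apply/forallP => x; rewrite permE porbitE.
apply/setP => B; apply/imsetP/idP => [[x _ ->]|BP].
  by rewrite porbitE pblock_mem.
have /set0Pn[x xB] : B != set0 by apply: contraNneq P0 => <-.
by exists x; rewrite // porbitE (def_pblock tiP BP xB).
Qed.

End DecreasingCycles.

Theorem theorem3p3 (n : nat) (hn : 1 <= n) :
  num_avoiders n pattern_12_1to2 = bell n.
Proof.
have -> : num_avoiders n pattern_12_1to2 =
          #|[set s : {perm 'I_n} | decreasing_cycles s]|.
  (* [theta] is a bijection with inverse [hat], so one may count [s] instead of [pi]. *)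
  rewrite -(card_imset _ (@theta_inj n)); apply: eq_card => pi.
  rewrite inE; apply/idP/imsetP => [av | [s]].
    by exists (hat pi); rewrite ?hatK // inE -avoids_decreasing_cycles hatK.
  by rewrite inE -avoids_decreasing_cycles => av ->.
rewrite -(card_in_imset (f := fun s => porbits s)); last first.
  by move=> s1 s2; rewrite !inE; apply: porbits_decreasing_cycles_inj.
apply: eq_card => P; rewrite [RHS]inE; apply/imsetP/idP => [[s _ ->]|].
  exact: partition_porbits.
by case/porbits_decreasing_cycles_surj => s ds <-; exists s; rewrite ?inE.
Qed.
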